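(* Let $\theta\in(0,\pi)$ with $\cos\theta=s/r$, where $r,s\in\mathbb{Z}$, $0\le|s|<r$, $\gcd(r,s)=1$. A natural number $n$ belongs to $\mathcal{N}_\theta$ if and only if the system $$E_\theta^w:\ y^2=x(x+(r+s)w)(x-(r-s)w),$$ $$G_\theta^N:\ z^2=\big(x^2+2s(N+w)x-(r^2-s^2)w^2\big)^2+4(r^2-s^2)N^2x^2,$$ where $N=2n-w$, has a rational solution $(w,x,y,z)$ with $y\neq0$ and $0<w\le n$.
   Context: $\mathcal{N}_\theta$ denotes the set of natural numbers $n$ for which there exist positive rationals $a,b,c,d,e$ with $a^2+b^2-\frac{2s}{r}ab=c^2$, $a^2+d^2+\frac{2s}{r}ad=e^2$, and $a(b+d)=rn$. *)

(* Defs.v *)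
From HB Require Import structures.
From mathcomp Require Import all_boot all_order all_algebra.
Set Implicit Arguments. Unset Strict Implicit. Unset Printing Implicit Defensive.
Import Order.TTheory GRing.Theory Num.Theory.
Local Open Scope ring_scope.

Definition in_Ntheta (r s : int) (n : nat) : Prop :=
  exists a b c d e : rat,
    [/\ 0 < a, 0 < b, 0 < c, 0 < d & 0 < e] /\
    a ^+ 2 + b ^+ 2 - (2 * s%:~R / r%:~R) * a * b = c ^+ 2 /\
    a ^+ 2 + d ^+ 2 + (2 * s%:~R / r%:~R) * a * d = e ^+ 2 /\
    a * (b + d) = r%:~R * n%:R.

Definition system_solvable (r s : int) (n : nat) : Prop :=
  exists w x y z : rat,
    let rr : rat := r%:~R in
    let ss : rat := s%:~R in
    let N : rat := 2 * n%:R - w in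
    [/\ y ^+ 2 = x * (x + (rr + ss) * w) * (x - (rr - ss) * w),
        z ^+ 2 = (x ^+ 2 + 2 * ss * (N + w) * x - (rr ^+ 2 - ss ^+ 2) * w ^+ 2) ^+ 2
                 + 4 * (rr ^+ 2 - ss ^+ 2) * N ^+ 2 * x ^+ 2,
        y != 0,
        0 < w &
        w <= n%:R].

(* Main.v *)
Require Import Defs.
From HB Require Import structures.
From mathcomp Require Import all_boot all_order all_algebra.
From mathcomp Require Import ring lra zify.
Set Implicit Arguments.
Unset Strict Implicit.
Import Order.TTheory GRing.Theory Num.Theory.
Local Open Scope ring_scope.

(** Let k = s/r. Doubling the lengths, a pair of triangles with common side A and
    second sides B, D corresponds to AB = 2rw, AD = 2rN, and
    x = A (A - kB + C) / 2, y = Ax, z = EAx; the inequality w <= n says B <= D.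
    As exchanging B and D changes the sign of k, the real content is that a pair
    with b > d can be replaced by one with b <= d. Put t = b/a, u = d/a,
    l = c/a - t + k and m = e/a - u - k. With these parameters of the two conics
    the pairs become the points of the surface
    (l + m) (1 - k^2 - l m) = 2 g l m z^2, where g = rn, and t -> 0 as l -> 1 + k.
    The curve l m = tau on it is a twist of Y^2 = l^3 + tau l; its real locus is
    connected, so its rational points are dense once there are infinitely many,
    and l can be chosen close to 1 + k. There are infinitely many because repeated
    doubling drives the 2-adic valuation of l^2 / tau to minus infinity, unless
    l = m; in that case one first leaves the diagonal. *)

(** * The group law on the curves [l m = tau] *)

(* With [Y = l z] this is the curve [C Y^2 = l^3 + tau l] for [l > 0], that is, the
   curve [l m = tau] on the surface of [cevian_pt]. *)
Definition fiber_pt (tau C l : rat) : Prop :=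
  0 < l /\ exists z, l + tau / l = C * z ^+ 2.

(** Translation by the 2-torsion point at the origin; it exchanges the two terms of
    [l + tau / l]. *)
Lemma fiber_pt_inv tau C l : 0 < tau -> fiber_pt tau C l -> fiber_pt tau C (tau / l).
Proof.
move=> tau0 [l0 [z hz]]; split; first exact: divr_gt0.
by exists z; rewrite -hz; field; lra.
Qed.

(** The tangent construction. Points with [l ^+ 2 = tau] double to the origin, where [l] is no
    longer positive. *)
Lemma fiber_pt_double tau C l : 0 < tau -> 0 < C -> l ^+ 2 != tau ->
  fiber_pt tau C l ->
  fiber_pt tau C ((l ^+ 2 - tau) ^+ 2 / (4 * l * (l ^+ 2 + tau))).
Proof.
move=> tau0 C0 ltau [l0 [z hz]].
have l20 : 0 < l ^+ 2 by exact: exprn_gt0.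
have dl : l ^+ 2 - tau != 0 by rewrite subr_eq0.
have sl : 0 < l ^+ 2 + tau by lra.
split; first by rewrite divr_gt0 ?exprn_even_gt0 // mulr_gt0 //; lra.
have z0 : z != 0.
  apply: contra_eqN hz => /eqP ->; rewrite expr0n /= mulr0.
  by rewrite gt_eqF // addr_gt0 ?divr_gt0.
exists ((l ^+ 4 + 6 * tau * l ^+ 2 + tau ^+ 2) / (2 * C * l * z * (l ^+ 2 - tau))).
have eC : C = (l + tau / l) / z ^+ 2 by rewrite hz mulfK // expf_neq0.
rewrite eC; field.
by rewrite z0 dl /= (gt_eqF l0) (gt_eqF sl).
Qed.

(* The abscissa of the sum of the points [(l, l z)] and [(L, L Z)]. *)
Lemma fiber_pt_secant tau C l L z Z : 0 < l -> 0 < L -> 0 < C -> l != L -> z != Z ->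
  l + tau / l = C * z ^+ 2 -> L + tau / L = C * Z ^+ 2 ->
  fiber_pt tau C (C * l * L * (z - Z) ^+ 2 / (l - L) ^+ 2).
Proof.
move=> l0 L0 C0 lL zZ h H.
have dl : l - L != 0 by rewrite subr_eq0.
have dz : z - Z != 0 by rewrite subr_eq0.
have dl2 : 0 < (l - L) ^+ 2 by rewrite exprn_even_gt0.
have dz2 : 0 < (z - Z) ^+ 2 by rewrite exprn_even_gt0.
split; first by rewrite divr_gt0 // mulr_gt0 // mulr_gt0 // mulr_gt0.
have et : tau = l * (C * z ^+ 2 - l) by rewrite -h; field; lra.
have et' : tau = L * (C * Z ^+ 2 - L) by rewrite -H; field; lra.
(* Eliminating [tau] leaves an equation linear in [C], so both constants can be substituted before
   [field]. *)
have e : C * (l * z ^+ 2 - L * Z ^+ 2) = (l - L) * (l + L).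
  have e : L * (C * Z ^+ 2 - L) = l * (C * z ^+ 2 - l) by rewrite -et -et'.
  by lra.
have dD : l * z ^+ 2 - L * Z ^+ 2 != 0.
  apply: contra_eqN e => /eqP ->; rewrite mulr0 eq_sym mulf_neq0 //; lra.
have eC : C = (l - L) * (l + L) / (l * z ^+ 2 - L * Z ^+ 2) by rewrite -e mulfK.
set l3 := (X in X + _).
(* The ordinate at [l3] on the chord through the two points, divided by [l3]. *)
exists (((l * z - L * Z) / (l - L) * (l3 - l) + l * z) / l3).
rewrite /l3 et eC; field.
by rewrite dl dz dD /= (gt_eqF l0) (gt_eqF L0) gt_eqF //; lra.
Qed.

(** * Density of the rational points on such a curve *)

(** With [q] the quotient of the [z]-values at [l] and [L], the middle term is the abscissa of the
    sum. For large [L], [q] has order [L^(-1/2)] and dominates [l / L], so the factor of [l] is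
    close to [(1 - q) ^+ 2], which lies between [1 - 2 * e] and [1 - q]. *)
Lemma step_bounds (tau b l0 l L q e : rat) :
  0 < tau -> 0 < b -> b <= l -> l <= l0 -> l0 < L -> tau <= L ->
  0 < q -> 0 < e -> e < 1 / 2 -> q ^+ 2 * (L + tau / L) = l + tau / l ->
  l0 + tau / b < e ^+ 2 * L -> (1 + 2 * l0) ^+ 2 <= b * L ->
  b * (1 - 2 * e) < l * ((L ^+ 2 + tau) * (1 - q) ^+ 2 / (L - l) ^+ 2) <= l * (1 - q).
Proof.
move=> tau0 b0 bl ll0 l0L tL q0 e0 e12 q2 h1 h2.
have l_gt0 : 0 < l by exact: lt_le_trans bl.
have L0 : 0 < L by apply: lt_trans l0L; exact: lt_le_trans ll0.
have lL : l < L by exact: le_lt_trans l0L.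
have L20 : 0 < L ^+ 2 by exact: exprn_gt0.
have dL : 0 < (L - l) ^+ 2 by rewrite exprn_gt0 // subr_gt0.
have tlb : tau / l <= tau / b by rewrite ler_pM2l // lef_pV2.
have qe : q < e.
  have : q ^+ 2 * L < e ^+ 2 * L.
    have : 0 < q ^+ 2 * (tau / L) by rewrite mulr_gt0 ?exprn_gt0 ?divr_gt0.
    by lra.
  by rewrite ltr_pM2r // ltr_pXn2r // nnegrE ltW.
have qp : 0 < (1 - q) ^+ 2 by rewrite exprn_gt0 //; lra.
have up : (1 - q) * (L ^+ 2 + tau) <= (L - l) ^+ 2.
  have : ((1 + 2 * l0) * L) ^+ 2 <= (q * (L ^+ 2 + tau)) ^+ 2.
    have -> : (q * (L ^+ 2 + tau)) ^+ 2 =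
              (q ^+ 2 * (L + tau / L)) * (L * (L ^+ 2 + tau)).
      by field; rewrite gt_eqF.
    rewrite q2 exprMn; apply: (@le_trans _ _ (b * L * L ^+ 2)).
      by rewrite ler_pM2r.
    rewrite -mulrA; apply: ler_pM; [exact: ltW | | | ].
    - by rewrite mulr_ge0 // ltW.
    - by apply: le_trans bl _; rewrite lerDl divr_ge0 // ltW.
    - by rewrite ler_pM2l // lerDl ltW.
  rewrite ler_pXn2r // ?nnegrE ?mulr_ge0 //; [ | lra..].
  have : 0 <= (l0 - l) * L by rewrite mulr_ge0 //; lra.
  by have : 0 <= l ^+ 2 by [exact: sqr_ge0]; lra.
apply/andP; split.
  apply: (@le_lt_trans _ _ (l * (1 - 2 * e))); first by rewrite ler_pM2r //; lra.
  rewrite ltr_pM2l //; apply: (@lt_le_trans _ _ ((1 - q) ^+ 2)).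
    by have : 0 <= q ^+ 2 by [exact: sqr_ge0]; lra.
  rewrite ler_pdivlMr // mulrC ler_pM2r //.
  have : 0 <= l * (L - l) by rewrite mulr_ge0 //; lra.
  by have : 0 < l * L by [exact: mulr_gt0]; lra.
rewrite ler_pM2l // ler_pdivrMr //.
have -> : (L ^+ 2 + tau) * (1 - q) ^+ 2 = (1 - q) * ((1 - q) * (L ^+ 2 + tau)) by ring.
by rewrite ler_pM2l //; lra.
Qed.

(* Adding a fixed point [L] near infinity moves the abscissa down by steps that
   are bounded below but too short to jump over the interval. *)
Lemma fiber_dense tau C a b : 0 < tau -> 0 < C -> 0 < a -> a < b ->
  (forall M, exists2 L, M < L & fiber_pt tau C L) ->
  exists2 l, a < l < b & fiber_pt tau C l.
Proof.
move=> tau0 C0 a0 ab unb.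
have b0 : 0 < b by exact: lt_trans ab.
have [l0 bl0 Sl0] := unb b.
have l00 : 0 < l0 by exact: lt_trans bl0.
pose e := (1 - a / b) / 2.
have ab1 : a / b < 1 by rewrite ltr_pdivrMr // mul1r.
have ab0 : 0 < a / b by exact: divr_gt0.
have ae : b * (1 - 2 * e) = a by rewrite /e; field; rewrite gt_eqF.
have [e0 e12] : 0 < e /\ e < 1 / 2 by rewrite /e; split; lra.
clearbody e; clear ab0 ab1.
have tb0 : 0 < tau / b by exact: divr_gt0.
have [L [L0 [Z hZ]] [l0L tL tbL hL1 hL2]] : exists2 L, fiber_pt tau C L &
    [/\ l0 < L, tau <= L, tau < b * L, l0 + tau / b < e ^+ 2 * L
      & (1 + 2 * l0) ^+ 2 <= b * L].
  pose M2 := (l0 + tau / b) / e ^+ 2; pose M3 := (1 + 2 * l0) ^+ 2 / b.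
  have M20 : 0 < M2 by rewrite divr_gt0 ?exprn_gt0 // addr_gt0.
  have M30 : 0 < M3 by rewrite divr_gt0 ?exprn_gt0 //; lra.
  have [L ML SL] := unb (l0 + tau + tau / b + M2 + M3).
  exists L => //; split; [lra | lra | | | ].
  - by rewrite mulrC -ltr_pdivrMr //; lra.
  - by rewrite [_ * L]mulrC -ltr_pdivrMr ?exprn_gt0 // -/M2; lra.
  - by rewrite [b * L]mulrC -ler_pdivrMr // -/M3; lra.
have tL0 : 0 < tau / L by exact: divr_gt0.
(* Both [z]-values are taken positive: opposite signs would replace [1 - q] by [1 + q], and the
   abscissa would not go down. *)
have norm_ord l z : 0 < l -> l + tau / l = C * z ^+ 2 ->
    0 < `|z| /\ l + tau / l = C * `|z| ^+ 2.
  move=> lp hz; rewrite real_normK ?num_real //; split=> //.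
  rewrite normr_gt0; apply: contra_eqN hz => /eqP ->.
  by rewrite expr0n mulr0 gt_eqF // addr_gt0 ?divr_gt0.
have {}[] := norm_ord _ _ L0 hZ; set Z1 := `|Z| => Z0 {}hZ.
(* [w] bounds [(z1 / Z1) ^+ 2] from below for all [l >= b]; [q0] is a rational substitute for its
   square root. *)
pose w := b / (L + tau / L).
have w0 : 0 < w by rewrite divr_gt0 ?addr_gt0.
pose q0 := w / (1 + w).
have q00 : 0 < q0 by rewrite divr_gt0 ?addr_gt0.
have q0w : q0 ^+ 2 <= w.
  rewrite /q0 expr_div_n ler_pdivrMr ?exprn_gt0 ?addr_gt0 //.
  have : 0 < w ^+ 3 by exact: exprn_gt0.
  by have : 0 < w ^+ 2 by [exact: exprn_gt0]; lra.
have step l : fiber_pt tau C l -> b <= l -> l <= l0 ->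
    exists2 l', fiber_pt tau C l' & a < l' <= l - b * q0.
  move=> [lp [z hz]] bl ll0.
  have {}[] := norm_ord _ _ lp hz; set z1 := `|z| => z0 {}hz.
  have lL : l < L by exact: le_lt_trans l0L.
  have tlL : tau < l * L by apply: (lt_le_trans tbL); rewrite ler_pM2r.
  have zZ : z1 != Z1.
    have : 0 < (L - l) * (l * L - tau) / (l * L).
      by rewrite divr_gt0 ?mulr_gt0 // subr_gt0.
    have -> : (L - l) * (l * L - tau) / (l * L) = C * Z1 ^+ 2 - C * z1 ^+ 2.
      by rewrite -hz -hZ; field; rewrite !gt_eqF.
    by apply: contraTneq => ->; rewrite subrr ltxx.
  have q_gt0 : 0 < z1 / Z1 by exact: divr_gt0.
  have q2 : (z1 / Z1) ^+ 2 * (L + tau / L) = l + tau / l.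
    by rewrite hZ hz; field; rewrite gt_eqF.
  exists (C * l * L * (z1 - Z1) ^+ 2 / (l - L) ^+ 2).
    by apply: fiber_pt_secant => //; rewrite lt_eqF.
  have -> : C * l * L * (z1 - Z1) ^+ 2 / (l - L) ^+ 2 =
            l * ((L ^+ 2 + tau) * (1 - z1 / Z1) ^+ 2 / (L - l) ^+ 2).
    have -> : L ^+ 2 + tau = L * (C * Z1 ^+ 2) by rewrite -hZ; field; rewrite gt_eqF.
    by field; rewrite (gt_eqF Z0) !subr_eq0 (gt_eqF lL) (lt_eqF lL).
  have := step_bounds tau0 b0 bl ll0 l0L tL q_gt0 e0 e12 q2 hL1 hL2.
  rewrite ae => /andP[-> /le_trans]; apply.
  rewrite mulrBr mulr1 lerD2l lerN2 ler_pM //; [exact: ltW | exact: ltW | ].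
  suff : q0 ^+ 2 <= (z1 / Z1) ^+ 2 by rewrite ler_pXn2r // nnegrE ltW.
  apply: (le_trans q0w); rewrite ler_pdivrMr ?addr_gt0 // q2.
  by apply: (le_trans bl); rewrite lerDl divr_ge0 // ltW.
have eta0 : 0 < b * q0 by exact: mulr_gt0.
clearbody q0; clear - step eta0 bl0 Sl0.
have descent N : forall l, fiber_pt tau C l -> b <= l -> l <= l0 ->
    l < b + N%:R * (b * q0) -> exists2 l, a < l < b & fiber_pt tau C l.
  elim: N => [|N IH] l Sl bl ll0 lN; first by lra.
  have [l' Sl' /andP[al' l'l]] := step l Sl bl ll0.
  have [l'b|bl'] := ltP l' b; first by exists l' => //; rewrite al'.
  by apply: (IH l') => //; [lra | move: lN; rewrite -natr1; lra].
apply: (descent (Num.truncn ((l0 - b) / (b * q0))).+1 l0) => //; first exact: ltW.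
have x0 : 0 <= (l0 - b) / (b * q0) by rewrite divr_ge0 //; lra.
by have /andP[_] := truncn_itv x0; rewrite ltr_pdivrMr //; lra.
Qed.

(** Pigeonhole: [K.+1] terms fall into [K] intervals of length [e]. *)
Lemma close_pair (u : nat -> rat) (M e : rat) : 0 < e ->
  (forall n, 0 <= u n <= M) -> exists i j, (i < j)%N /\ `|u i - u j| < e.
Proof.
move=> e0 hu.
have ue n : 0 <= u n / e by rewrite divr_ge0 ?(ltW e0) //; case/andP: (hu n).
pose K := (Num.truncn (M / e)).+1.
have bd (n : 'I_K.+1) : (Num.truncn (u n / e) < K)%N.
  have /andP[_ uM] := hu n.
  by rewrite ltnS le_truncn // ler_pM2r ?invr_gt0.
pose f n := Ordinal (bd n).
have /injectivePn[i [j ij fij]] : ~~ injectiveb f.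
  by apply/injectiveP => /leq_card; rewrite !card_ord ltnn.
have close (x y : 'I_K.+1) : f x = f y -> u x - u y < e.
  move=> [fxy].
  have /andP[_ h1] := truncn_itv (ue x).
  have /andP[h2 _] := truncn_itv (ue y).
  move: h1; rewrite fxy -natr1 => h1.
  have : u x / e < u y / e + 1 by lra.
  by rewrite -[1](divff (lt0r_neq0 e0)) -mulrDl ltr_pM2r ?invr_gt0 //; lra.
have h1 := close _ _ fij; have h2 := close _ _ (esym fij).
have [lt_ij|lt_ji|/val_inj/eqP] := ltngtP i j; last by rewrite (negbTE ij).
- by exists i, j; rewrite lt_ij ltr_norml; split=> //; lra.
- by exists j, i; rewrite lt_ji ltr_norml; split=> //; lra.
Qed.

(** A point beyond [M] is wanted; one below [tau / M] gives it by [fiber_pt_inv]. If all points lie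
    in between, two are close, and the secant formula has a small denominator. *)
Lemma fiber_unbounded tau C (u : nat -> rat) : 0 < tau -> 0 < C ->
  (forall n, fiber_pt tau C (u n)) -> (forall i j, (i < j)%N -> u i != u j) ->
  forall M, exists2 L, M < L & fiber_pt tau C L.
Proof.
move=> tau0 C0 Su uinj M.
wlog M0 : M / 0 < M.
  move=> /(_ (`|M| + 1)) [|L ML SL]; first by have := normr_ge0 M; lra.
  by exists L => //; apply: le_lt_trans ML; have := ler_norm M; lra.
have e0 : 0 < tau / M by exact: divr_gt0.
(* Truncating at [M] makes [close_pair] applicable before it is known whether some [u n] exceeds
   [M]. *)
have bd n : 0 <= Num.min (u n) M <= M.
  by rewrite le_min ge_min lexx orbT andbT (ltW M0) andbT ltW //; case: (Su n).
have [i [j [/uinj uij dij]]] := close_pair e0 bd.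
have far n : M < u n \/ u n < tau / M -> exists2 L, M < L & fiber_pt tau C L.
  move=> [Mu|uM]; first by exists (u n).
  have [un0 _] := Su n.
  exists (tau / u n); last exact: fiber_pt_inv.
  by rewrite ltr_pdivlMr // mulrC -ltr_pdivlMr.
have [ui|Mi] := leP (u i) M; last by apply: (far i); left.
have [uj|Mj] := leP (u j) M; last by apply: (far j); left.
have [iu|iM] := leP (tau / M) (u i); last by apply: (far i); right.
have [ju|jM] := leP (tau / M) (u j); last by apply: (far j); right.
move: dij; rewrite !min_l // => dij.
have [[li [z hz]] [lj [Z hZ]]] := (Su i, Su j).
have zn0 : z != 0.
  apply: contra_eqN hz => /eqP ->.
  by rewrite expr0n mulr0 gt_eqF // addr_gt0 ?divr_gt0.
have z0 : 0 < `|z| by rewrite normr_gt0.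
have Z0 : 0 <= `|Z| by [].
(* Opposite signs turn [z - Z] into a sum of absolute values, which keeps the numerator away from
   0. *)
have zZ : `|z| != - `|Z| by rewrite gt_eqF //; lra.
move: hz hZ; rewrite -[z ^+ 2]real_normK ?num_real // -[Z ^+ 2]real_normK ?num_real //.
rewrite -[`|Z| ^+ 2]sqrrN => hz hZ.
eexists; last exact: (fiber_pt_secant li lj C0 uij zZ hz hZ).
have dl : 0 < (u i - u j) ^+ 2 by rewrite exprn_even_gt0 //= subr_eq0.
rewrite ltr_pdivlMr //.
apply: (@lt_le_trans _ _ (M * (tau / M) ^+ 2)).
  rewrite ltr_pM2l // -[X in X < _]real_normK ?num_real //.
  by rewrite ltr_pXn2r ?nnegrE // ltW.
have -> : M * (tau / M) ^+ 2 = tau * (tau / M) by field; rewrite gt_eqF.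
apply: (@le_trans _ _ (tau * u j)); first by rewrite ler_pM2l.
apply: (@le_trans _ _ (C * u i * u j * `|z| ^+ 2)).
  have -> : C * u i * u j * `|z| ^+ 2 = (u i * (C * `|z| ^+ 2)) * u j by ring.
  rewrite -hz ler_pM2r // mulrDr [_ * (tau / _)]mulrC divfK ?gt_eqF //.
  by rewrite lerDr mulr_ge0 // ltW.
rewrite ler_pM2l ?mulr_gt0 // ler_pXn2r // ?nnegrE; lra.
Qed.

(** * 2-adic valuations under doubling, and density from a single point *)

Definition odd_rat (x : rat) := exists c : int, x = (2 * c + 1)%:~R.

Lemma odd_rat1 : odd_rat 1.
Proof. by exists 0. Qed.

Lemma odd_ratM x y : odd_rat x -> odd_rat y -> odd_rat (x * y).
Proof.
move=> [a ->] [b ->]; exists (2 * a * b + a + b); rewrite -intrM.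
by congr (_%:~R); ring.
Qed.

Lemma odd_ratX x n : odd_rat x -> odd_rat (x ^+ n).
Proof.
move=> ox; elim: n => [|n IH]; first exact: odd_rat1.
by rewrite exprS; apply: odd_ratM.
Qed.

Lemma odd_rat_even x (c : int) : odd_rat x -> odd_rat (x + 2 * c%:~R).
Proof. by move=> [a ->]; exists (a + c); rewrite !(intrD, intrM); ring. Qed.

Lemma odd_rat_nat (n : nat) : odd n -> odd_rat n%:R.
Proof.
move=> on; exists n./2%:Z; rewrite pmulrn -{1}(odd_double_half n) on.
by congr (_%:~R); lia.
Qed.

Lemma odd_rat_neq_even x (c : int) : odd_rat x -> x != 2 * c%:~R.
Proof.
move=> [a ->]; apply/eqP => h.
have /intr_inj : (2 * a + 1)%:~R = (2 * c)%:~R :> rat by rewrite h intrM.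
lia.
Qed.

Lemma odd_rat_neq0 x : odd_rat x -> x != 0.
Proof. by move=> /(odd_rat_neq_even 0); rewrite mulr0. Qed.

Lemma odd_ratN x : odd_rat x -> odd_rat (- x).
Proof. by move=> ox; rewrite -mulN1r; apply: odd_ratM => //; exists (-1). Qed.

Lemma odd_ratD2X x y i : odd_rat x -> odd_rat y -> odd_rat (x + 2 ^+ i.+1 * y).
Proof.
move=> ox [c ->].
have -> : 2 ^+ i.+1 * (2 * c + 1)%:~R = 2 * (2 ^+ i * (2 * c + 1))%:~R :> rat.
  by rewrite intrM rmorphXn /= exprS mulrA.
exact: odd_rat_even.
Qed.

Lemma two_power_part (m : int) : m != 0 ->
  exists i a, odd_rat a /\ m%:~R = 2 ^+ i * a :> rat.
Proof.
move=> m0.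
have m0' : (0 < `|m|)%N by rewrite absz_gt0.
have [q] := pfactor_coprime (isT : prime 2) m0'.
rewrite coprime2n => oq mE.
exists (logn 2 `|m|), ((-1) ^+ (m < 0)%R * q%:R); split.
  apply: odd_ratM; last exact: odd_rat_nat.
  by apply: odd_ratX; exists (-1).
rewrite {1}[m]intEsign intrM rmorph_sign -pmulrn {1}mE natrM natrX. by ring.
Qed.

(* The effect on [r = l^2 / tau] of doubling a point of the curve. *)
Definition dbl (r : rat) := (r - 1) ^+ 4 / (16 * r * (r + 1) ^+ 2).

(* [r] has 2-adic valuation [- j.+1]. *)
Definition val2 (j : nat) (r : rat) := exists a b,
  [/\ odd_rat a, odd_rat b & r = a / (2 ^+ j.+1 * b)].

(** [r - 1] and [r + 1] have the same negative valuation as [r]; the powers 4 - 1 - 2 leave one copy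
    of it, and the factor 16 lowers it by 4. *)
Lemma val2_dbl j r : val2 j r -> val2 (j + 4) (dbl r).
Proof.
move=> [a [b [oa ob ->]]].
have o1 : odd_rat (a - 2 ^+ j.+1 * b).
  by rewrite -mulrN; apply: odd_ratD2X => //; apply: odd_ratN.
have o2 : odd_rat (a + 2 ^+ j.+1 * b) by exact: odd_ratD2X.
exists ((a - 2 ^+ j.+1 * b) ^+ 4), (b * a * (a + 2 ^+ j.+1 * b) ^+ 2); split.
- exact: odd_ratX.
- by do !apply: odd_ratM => //; apply: odd_ratX.
have a0 := odd_rat_neq0 oa; have b0 := odd_rat_neq0 ob.
have s0 := odd_rat_neq0 o2.
have t0 : 2 ^+ j.+1 != 0 :> rat by rewrite expf_neq0.
rewrite -addSn exprD /dbl; move: t0 s0; set t := 2 ^+ j.+1 => t0 s0.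
by field; rewrite a0 b0 s0 t0.
Qed.

Lemma val2_neq0 j r : val2 j r -> r != 0.
Proof.
move=> [a [b [oa ob ->]]].
by rewrite mulf_neq0 ?invr_eq0 ?mulf_neq0 ?expf_neq0 // odd_rat_neq0.
Qed.

Lemma val2_neq1 j r : val2 j r -> r != 1.
Proof.
move=> [a [b [oa ob ->]]].
have b0 := odd_rat_neq0 ob.
rewrite -subr_eq0 (_ : _ - 1 = (a - 2 ^+ j.+1 * b) / (2 ^+ j.+1 * b)); last first.
  by field; rewrite b0 expf_neq0.
rewrite mulf_neq0 ?invr_eq0 ?mulf_neq0 ?expf_neq0 //.
by apply: odd_rat_neq0; rewrite -mulrN; apply: odd_ratD2X => //; apply: odd_ratN.
Qed.

Lemma val2_lt_neq i j r s : (i < j)%N -> val2 i r -> val2 j s -> r != s.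
Proof.
move=> ij [a [b [oa ob ->]]] [c [d [oc od ->]]].
have b0 := odd_rat_neq0 ob; have d0 := odd_rat_neq0 od.
have two0 n : 2 ^+ n != 0 :> rat by rewrite expf_neq0.
have -> : j.+1 = (i.+1 + (j - i.+1).+1)%N by lia.
rewrite exprD -subr_eq0.
set t := 2 ^+ (j - i.+1).+1; set t' := 2 ^+ i.+1.
have -> : a / (t' * b) - c / (t' * t * d) = - (c * b - t * (a * d)) / (t' * t * b * d).
  by field; rewrite b0 d0 !two0.
rewrite mulf_neq0 ?invr_eq0 ?mulf_neq0 ?two0 // oppr_eq0.
apply: odd_rat_neq0; rewrite -mulrN; apply: odd_ratD2X; first exact: odd_ratM.
by apply: odd_ratN; apply: odd_ratM.
Qed.

(* Two doublings suffice: if [r] is a quotient of odd numbers, the valuation of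
   [dbl r] is nonzero because exactly one of [r - 1], [r + 1] has valuation 1. *)
Lemma val2_dbl_start r : 0 < r -> r != 1 ->
  exists j, [\/ val2 j r, val2 j (dbl r) | val2 j (dbl (dbl r))].
Proof.
move=> r0 r1.
(* For positive valuation [s - 1] and [s + 1] are 2-adic units, so only [16 * s] in the denominator
   counts. *)
have pos_dbl s i a b : odd_rat a -> odd_rat b -> s = 2 ^+ i.+1 * a / b ->
    val2 (i + 4) (dbl s).
  move=> oa ob ->.
  have a0 := odd_rat_neq0 oa; have b0 := odd_rat_neq0 ob.
  have t0 : 2 ^+ i.+1 != 0 :> rat by rewrite expf_neq0.
  have o1 : odd_rat (b - 2 ^+ i.+1 * a).
    by rewrite -mulrN; apply: odd_ratD2X => //; apply: odd_ratN.
  have o2 : odd_rat (b + 2 ^+ i.+1 * a) by exact: odd_ratD2X.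
  exists ((b - 2 ^+ i.+1 * a) ^+ 4), (b * a * (b + 2 ^+ i.+1 * a) ^+ 2); split.
  - exact: odd_ratX.
  - by do !apply: odd_ratM => //; apply: odd_ratX.
  have s0 := odd_rat_neq0 o2.
  rewrite -addSn exprD /dbl; move: t0 s0; set t := 2 ^+ i.+1 => t0 s0.
  by field; rewrite a0 b0 t0 s0.
have rE : r = (numq r)%:~R / (denq r)%:~R by rewrite divq_num_den.
have n0 : numq r != 0 by rewrite numq_eq0 gt_eqF.
have [i [a [oa na]]] := two_power_part n0.
have [j [b [ob db]]] := two_power_part (denq_neq0 r).
have a0 := odd_rat_neq0 oa; have b0 := odd_rat_neq0 ob.
have two0 n : 2 ^+ n != 0 :> rat by rewrite expf_neq0.
rewrite na db in rE.
have [ij|ji|ij] := ltngtP i j.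
- have [m jE] : exists m, j = (i + m.+1)%N by exists (j - i.+1)%N; lia.
  exists m; apply: Or31; exists a, b; split=> //.
  by rewrite rE jE exprD; field; rewrite b0 !two0.
- have [m iE] : exists m, i = (j + m.+1)%N by exists (i - j.+1)%N; lia.
  exists (m + 4)%N; apply: Or32; apply: (pos_dbl _ _ a b) => //.
  by rewrite rE iE exprD; field; rewrite b0 !two0.
have {}rE : r = a / b by rewrite rE ij; field; rewrite b0 two0.
case: oa ob (a0) (b0) => p pE [q qE] _ _.
(* [p - q] and [p + q + 1] are the halves of [a - b] and [a + b]. Their sum is the odd number [a],
   so exactly one of them is even. *)
have nz1 : p - q != 0.
  rewrite subr_eq0; apply: contra_neq r1 => pq.
  by rewrite rE pE qE pq divff // -qE.
have nz2 : p + q + 1 != 0.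
  apply: contraTneq r0 => pq; rewrite -leNgt rE.
  have -> : a = - b by rewrite pE qE -mulrNz; congr (_%:~R); lia.
  by rewrite mulNr divff // lerN10.
have [i1 [d [od dE]]] := two_power_part nz1.
have [j1 [e [oe eE]]] := two_power_part nz2.
have d0 := odd_rat_neq0 od; have e0 := odd_rat_neq0 oe.
have oa : odd_rat a by exists p.
have ob : odd_rat b by exists q.
have abd : a - b = 2 ^+ i1.+1 * d.
  by rewrite exprS -mulrA -dE pE qE !(intrD, intrM, rmorphN) /=; ring.
have abe : a + b = 2 ^+ j1.+1 * e.
  by rewrite exprS -mulrA -eE pE qE !(intrD, intrM, rmorphN) /=; ring.
have rdE : dbl r = 2 ^+ i1.+1 ^+ 4 * d ^+ 4 / (16 * a * b * (2 ^+ j1.+1 * e) ^+ 2).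
  rewrite -abe -exprMn -abd rE /dbl; field.
  by rewrite a0 b0 abe mulf_neq0.
have aE : a = 2 ^+ i1 * d + 2 ^+ j1 * e.
  by rewrite -dE -eE pE !(intrD, intrM, rmorphN) /=; ring.
case: i1 dE abd rdE aE => [|i1] dE abd rdE aE.
  case: j1 eE abe rdE aE => [|j1] eE abe rdE aE.
    case: od oe aE => d' -> [e' ->] aE.
    have /eqP[] := odd_rat_neq_even (d' + e' + 1) oa.
    by rewrite aE !(intrD, intrM) /=; ring.
  (* The valuation of [dbl r] is [4 - 4 - 2 (j1 + 2)], already negative. *)
  exists (2 * j1.+1 + 1)%N; apply: Or32.
  exists (d ^+ 4), (a * b * e ^+ 2); split; first exact: odd_ratX.
    by do !apply: odd_ratM => //; apply: odd_ratX.
  rewrite rdE (_ : (2 * j1.+1 + 1).+1 = j1.+2 + j1.+2)%N; last lia.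
  by rewrite exprD; field; rewrite a0 b0 e0 two0.
case: j1 eE abe rdE aE => [|j1] eE abe rdE aE; last first.
  case: od oe aE => d' -> [e' ->] aE.
  have /eqP[] := odd_rat_neq_even (2 ^+ i1 * (2 * d' + 1) + 2 ^+ j1 * (2 * e' + 1)) oa.
  by rewrite aE !(intrD, intrM, rmorphXn) /= !exprS; ring.
(* Here it is [4 (i1 + 2) - 4 - 2 > 0], and a second doubling makes it negative. *)
exists (4 * i1 + 1 + 4)%N; apply: Or33.
apply: (pos_dbl _ _ (d ^+ 4) (a * b * e ^+ 2)); first exact: odd_ratX.
  by do !apply: odd_ratM => //; apply: odd_ratX.
rewrite rdE (_ : (4 * i1 + 1).+1 = i1 + i1 + i1 + i1 + 2)%N ?exprD; last lia.
by rewrite !exprS expr0; field; rewrite a0 b0 e0.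
Qed.

(** From some multiple of the point on, the valuation of [l ^+ 2 / tau] falls by 4 at each doubling,
    so the doubles are pairwise distinct. *)
Lemma fiber_pt_dense tau C l a b : 0 < tau -> 0 < C -> fiber_pt tau C l ->
  l ^+ 2 != tau -> 0 < a -> a < b -> exists2 x, a < x < b & fiber_pt tau C x.
Proof.
move=> tau0 C0 Sl ltau a0 ab.
apply: fiber_dense => //.
pose D l := (l ^+ 2 - tau) ^+ 2 / (4 * l * (l ^+ 2 + tau)).
pose ratio x := x ^+ 2 / tau.
have tau_n0 := lt0r_neq0 tau0.
have ratio1 x : (ratio x == 1) = (x ^+ 2 == tau).
  by rewrite /ratio -(inj_eq (mulIf tau_n0)) divfK // mul1r.
have ratioD x : fiber_pt tau C x -> ratio (D x) = dbl (ratio x).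
  move=> [x0 _]; have s0 : 0 < x ^+ 2 + tau by rewrite addr_gt0 ?exprn_gt0.
  by rewrite /ratio /dbl /D; field; rewrite !gt_eqF.
have SD x : ratio x != 1 -> fiber_pt tau C x -> fiber_pt tau C (D x).
  by rewrite ratio1; apply: fiber_pt_double.
have [j [l' Sl' vl']] : exists j, exists2 x, fiber_pt tau C x & val2 j (ratio x).
  have [l0 _] := Sl.
  have r1 : ratio l != 1 by rewrite ratio1.
  have [|j []] := @val2_dbl_start (ratio l) _ r1; first by rewrite divr_gt0 ?exprn_gt0.
  - by exists j, l.
  - by rewrite -ratioD // => v; exists j, (D l) => //; apply: SD.
  have SDl := SD _ r1 Sl.
  rewrite -!ratioD // => v; exists j, (D (D l)) => //; apply: SD => //.
  (* If [D l] had ratio 1, the next ratio would be 0, which has no valuation. *)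
  apply: contraPneq v => r1'; rewrite ratioD // r1' /dbl subrr expr0n mul0r.
  by move=> /val2_neq0; rewrite eqxx.
have val_iter n : fiber_pt tau C (iter n D l') /\ val2 (j + 4 * n) (ratio (iter n D l')).
  elim: n => [|n [Sn vn]]; first by rewrite muln0 addn0.
  rewrite iterS ratioD // mulnS [(4 + _)%N]addnC addnA; split; last exact: val2_dbl.
  by apply: SD => //; apply: val2_neq1 vn.
apply: (fiber_unbounded (u := fun n => iter n D l')) => // [n|i i' ii'].
  by case: (val_iter n).
have [[_ vi] [_ vi']] := (val_iter i, val_iter i').
have : ratio (iter i D l') != ratio (iter i' D l').
  by apply: val2_lt_neq vi vi'; rewrite ltn_add2l ltn_pmul2l.
by apply: contra_neq => ->.
Qed.

(** * The surface of pairs of triangles *)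

(** Glued along [a], the triangles form one with base [b + d] and cevian [a]; [z] is [1 / a]. The
    bound on [l * m] makes [b + d] positive, not [b] and [d] separately: leaving the diagonal may
    lose that, and [cevian_pt_near] restores it. *)
Definition cevian_pt (k g l m : rat) := [/\ 0 < l, 0 < m, l * m < 1 - k ^+ 2 &
  exists z, (l + m) * (1 - k ^+ 2 - l * m) = 2 * g * l * m * z ^+ 2].

Lemma cevian_pt_of_triangles (k g a b c d e : rat) : k ^+ 2 < 1 ->
  [/\ 0 < a, 0 < b, 0 < c, 0 < d & 0 < e] ->
  a ^+ 2 + b ^+ 2 - 2 * k * a * b = c ^+ 2 ->
  a ^+ 2 + d ^+ 2 + 2 * k * a * d = e ^+ 2 ->
  a * (b + d) = g ->
  cevian_pt k g ((c - b) / a + k) ((e - d) / a - k).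
Proof.
move=> k1 [a0 b0 c0 d0 e0] hc he <-.
have ak0 : 0 < a ^+ 2 * (1 - k ^+ 2) by rewrite mulr_gt0 ?exprn_gt0 // subr_gt0.
have pos (x y : rat) : 0 < x -> y ^+ 2 < x ^+ 2 -> 0 < x - y.
  move=> x0 yx; rewrite subr_gt0; have [//|xy] := ltP y x.
  have : x ^+ 2 <= y ^+ 2 by rewrite ler_pXn2r // nnegrE ?(le_trans (ltW x0)) // ltW.
  by rewrite leNgt yx.
have l0 : 0 < c - (b - k * a) by apply: pos => //; rewrite -hc; lra.
have m0 : 0 < e - (d + k * a) by apply: pos => //; rewrite -he; lra.
set l := _ + k; set m := _ - k.
have lE : l = (c - (b - k * a)) / a by rewrite /l; field; rewrite gt_eqF.
have mE : m = (e - (d + k * a)) / a by rewrite /m; field; rewrite gt_eqF.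
have lp : 0 < l by rewrite lE divr_gt0.
have mp : 0 < m by rewrite mE divr_gt0.
have key : (l + m) * (1 - k ^+ 2 - l * m) = 2 * (a * (b + d)) * l * m * a^-1 ^+ 2.
  (* The first conic is [(c / a)^2 - (b / a - k)^2 = 1 - k^2], and [l] is one factor of the left
     side; [m] plays the same role for the second. *)
  have h1 : 1 - k ^+ 2 = l * ((c + (b - k * a)) / a).
    have -> : l * ((c + (b - k * a)) / a) = (c ^+ 2 - (b - k * a) ^+ 2) / a ^+ 2.
      by rewrite lE; field; rewrite gt_eqF.
    by rewrite -hc; field; rewrite gt_eqF.
  have h2 : 1 - k ^+ 2 = m * ((e + (d + k * a)) / a).
    have -> : m * ((e + (d + k * a)) / a) = (e ^+ 2 - (d + k * a) ^+ 2) / a ^+ 2.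
      by rewrite mE; field; rewrite gt_eqF.
    by rewrite -he; field; rewrite gt_eqF.
  rewrite mulrDl {1}h2 {1}h1 lE mE; field; rewrite gt_eqF //.
split=> //; last by exists a^-1.
rewrite -subr_gt0 -(pmulr_rgt0 _ (addr_gt0 lp mp)) key.
have h : 0 < a * (b + d) by rewrite mulr_gt0 ?addr_gt0.
rewrite pmulr_lgt0 ?exprn_gt0 ?invr_gt0 // pmulr_lgt0 // pmulr_lgt0 //; lra.
Qed.

(* On the diagonal [l = m] the curve [l * m = const] only yields a point of
   finite order, so one first leaves it, by a translation by a 2-torsion point of
   the curve [l = const]; that fails for equilateral triangles, which are replaced
   by a nonequilateral isosceles one. *)
Lemma cevian_pt_neq k g l m : 0 < g -> cevian_pt k g l m ->
  exists l' m', cevian_pt k g l' m' /\ l' != m'.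
Proof.
move=> g0 hlm; have [ml|lm] := eqVneq m l; last by exists l, m; rewrite eq_sym.
move: hlm; rewrite {}ml => {m} hll.
have generic x : 1 - k ^+ 2 != 3 * x ^+ 2 -> cevian_pt k g x x ->
    exists l' m', cevian_pt k g l' m' /\ l' != m'.
  move=> kap [x0 _ xk [z hz]].
  have x20 : 0 < x * x by exact: mulr_gt0.
  set K := 1 - k ^+ 2 in kap xk hz *.
  have Kx : 0 < K - x ^+ 2 by rewrite subr_gt0 expr2.
  have hz2 : K - x ^+ 2 = g * x * z ^+ 2.
    by apply: (mulfI (lt0r_neq0 (_ : 0 < 2 * x))); [lra | move: hz; lra].
  have z0 : z != 0.
    by apply: contra_eqN hz2 => /eqP ->; rewrite expr0n mulr0 subr_eq0 expr2 gt_eqF.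
  exists x, ((K - x ^+ 2) / (2 * x)); split; last first.
    apply: contra_neq kap => xE.
    have : x * (2 * x) = K - x ^+ 2 by rewrite {1}xE divfK // lt0r_neq0 //; lra.
    by lra.
  split=> //; first by rewrite divr_gt0 //; lra.
    have -> : x * ((K - x ^+ 2) / (2 * x)) = (K - x ^+ 2) / 2 by field; rewrite gt_eqF.
    by rewrite -/K; lra.
  exists ((K + x ^+ 2) / (2 * g * x * z)); rewrite -/K.
  have -> : 2 * g * x * ((K - x ^+ 2) / (2 * x)) * ((K + x ^+ 2) / (2 * g * x * z)) ^+ 2
     = (K - x ^+ 2) * (K + x ^+ 2) ^+ 2 / (4 * x * (g * x * z ^+ 2)).
    by field; rewrite z0 !gt_eqF.
  by rewrite -hz2; field; rewrite (gt_eqF x0) (gt_eqF Kx).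
have [kap|kap] := eqVneq (1 - k ^+ 2) (3 * l ^+ 2).
  have [l0 _ _ [z hz]] := hll.
  have hz2 : 2 * l = g * z ^+ 2.
    apply: (mulfI (lt0r_neq0 (exprn_gt0 2 l0))).
    by move: hz; rewrite kap; lra.
  (* On the diagonal curve the tangent at [l] meets the curve again at [-2 l]; translation by the
     origin, [x -> -3 l^2 / x], takes this to [3 / 2 * l]. *)
  have h3 : cevian_pt k g (3 / 2 * l) (3 / 2 * l).
    have l20 : 0 < l ^+ 2 by exact: exprn_gt0.
    split; [lra | lra | rewrite kap; lra | exists (z / 2)].
    have -> : 2 * g * (3 / 2 * l) * (3 / 2 * l) * (z / 2) ^+ 2 =
              9 / 8 * l ^+ 2 * (g * z ^+ 2) by field.
    by rewrite -hz2 kap; field.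
  have l20 : 0 < l ^+ 2 by exact: exprn_gt0.
  by apply: generic h3; rewrite kap; lra.
exact: generic hll.
Qed.

(** With [tau] fixed and [l'] tending to [1 + k], the left side of the last inequality tends to 0,
    while [m'] tends to [tau / (1 + k) < 1 - k], so the right side stays away from 0. *)
Lemma cevian_pt_near k g l m : 0 < g -> cevian_pt k g l m -> l != m -> k ^+ 2 < 1 ->
  exists l' m', [/\ cevian_pt k g l' m', l' < 1 + k, m' < 1 - k &
    (1 + k - l') * (1 - k + l') / l' <= (1 - k - m') * (1 + k + m') / m'].
Proof.
move=> g0 [l0 m0 lmk [z hz]] lm k1.
have [kp km] : 0 < 1 + k /\ 0 < 1 - k.
  have : `|k| < 1.
    rewrite -(ltr_pXn2r (_ : 0 < 2)%N) ?nnegrE // -normrX.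
    by rewrite ger0_norm ?sqr_ge0 ?expr1n.
  by rewrite ltr_norml => /andP[]; split; lra.
pose tau := l * m; pose C := 2 * g * tau / (1 - k ^+ 2 - tau).
have tau0 : 0 < tau by exact: mulr_gt0.
have dk0 : 0 < 1 - k ^+ 2 - tau by rewrite subr_gt0.
have C0 : 0 < C by rewrite divr_gt0 // !mulr_gt0.
have Sl : fiber_pt tau C l.
  split=> //; exists z; rewrite /C.
  have -> : l + tau / l = l + m by rewrite /tau; field; rewrite gt_eqF.
  apply: (mulIf (lt0r_neq0 dk0)).
  by rewrite hz /tau; field; rewrite gt_eqF.
have ltau : l ^+ 2 != tau by rewrite expr2 (inj_eq (mulfI (lt0r_neq0 l0))).
(* For [x = 1 + k - h] the estimates below need [(3 - k) h <= 1 - k^2 - tau]; since [3 - k < 4],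
   [h < d] suffices. *)
pose d := (1 - k ^+ 2 - tau) / 4.
have d0 : 0 < d by rewrite divr_gt0.
have dk : d < 1 + k.
  have := mulr_gt0 kp kp.
  by rewrite /d; lra.
have a0 : 0 < 1 + k - d by rewrite subr_gt0.
have ab : 1 + k - d < 1 + k by rewrite ltrBlDr ltrDl.
have [x /andP[ax xb] [x0 [y hy]]] := fiber_pt_dense tau0 C0 Sl ltau a0 ab.
have xk : tau < (1 - k) * x.
  have : 0 < (1 - k) * (x - (1 + k - d)) by rewrite mulr_gt0 // subr_gt0.
  have : 0 < (1 + k) * d by exact: mulr_gt0.
  by rewrite /d; lra.
have mx : tau / x < 1 - k by rewrite ltr_pdivrMr.
exists x, (tau / x); split=> //.
  split=> //; first exact: divr_gt0.
    by rewrite [x * _]mulrC divfK ?gt_eqF // -subr_gt0.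
  exists y.
  have -> : x * (tau / x) = tau by rewrite mulrC divfK ?gt_eqF.
  rewrite hy /C -[2 * g * x * _]mulrA [x * _]mulrC divfK ?gt_eqF //.
  by field; rewrite gt_eqF.
have -> : (1 - k - tau / x) * (1 + k + tau / x) / (tau / x) =
          ((1 - k) * x - tau) * ((1 + k) * x + tau) / tau / x.
  by field; rewrite !gt_eqF.
rewrite ler_pM2r ?invr_gt0 // ler_pdivlMr //.
have e0 : 0 < 1 + k - x by rewrite subr_gt0.
apply: (@le_trans _ _ ((1 + k - x) * 2 * tau)).
  by rewrite ler_pM2r // ler_pM2l //; lra.
apply: (@le_trans _ _ (((1 - k) * x - tau) * tau)); last first.
  by rewrite ler_pM2l ?subr_gt0 // lerDr mulr_ge0 // ltW.
rewrite ler_pM2r //.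
have : 0 < (1 + k) * (1 + k - x) by exact: mulr_gt0.
by move: ax; rewrite /d; lra.
Qed.

(** Inverse of the parametrization, with [a = 1 / |z|]. The bounds on [l] and [m] make [b] and [d]
    positive; the last hypothesis is [b <= d]. *)
Lemma triangles_of_cevian_pt (k g l m : rat) : 0 < g -> cevian_pt k g l m ->
  l < 1 + k -> m < 1 - k ->
  (1 + k - l) * (1 - k + l) / l <= (1 - k - m) * (1 + k + m) / m ->
  exists a b c d e, [/\ 0 < a, 0 < b, 0 < c, 0 < d & 0 < e] /\
    [/\ a ^+ 2 + b ^+ 2 - 2 * k * a * b = c ^+ 2,
        a ^+ 2 + d ^+ 2 + 2 * k * a * d = e ^+ 2,
        a * (b + d) = g & b <= d].
Proof.
move=> g0 [l0 m0 lmk [z hz]] lk mk htu.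
have z0 : z != 0.
  apply: contra_eqN hz => /eqP ->.
  by rewrite expr0n mulr0 gt_eqF // mulr_gt0 ?subr_gt0 // addr_gt0.
have k0 : 0 < 1 - k ^+ 2 by apply: lt_trans lmk; exact: mulr_gt0.
pose a := `|z|^-1.
have a0 : 0 < a by rewrite invr_gt0 normr_gt0.
pose t := (1 + k - l) * (1 - k + l) / l / 2.
pose u := (1 - k - m) * (1 + k + m) / m / 2.
pose c := ((1 - k ^+ 2) / l + l) / 2.
pose e := ((1 - k ^+ 2) / m + m) / 2.
have [t0 u0 c0 e0] : [/\ 0 < t, 0 < u, 0 < c & 0 < e].
  split; apply: divr_gt0 => //; try by rewrite addr_gt0 // divr_gt0.
    by apply: divr_gt0 => //; apply: mulr_gt0; lra.
  by apply: divr_gt0 => //; apply: mulr_gt0; lra.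
have tu : t <= u by rewrite ler_pM2r.
have hc : 1 + t ^+ 2 - 2 * k * t = c ^+ 2 by rewrite /t /c; field; rewrite gt_eqF.
have he : 1 + u ^+ 2 + 2 * k * u = e ^+ 2 by rewrite /u /e; field; rewrite gt_eqF.
have hg : (t + u) * a ^+ 2 = g.
  have -> : t + u = (l + m) * (1 - k ^+ 2 - l * m) / (2 * l * m).
    by rewrite /t /u; field; rewrite !gt_eqF.
  rewrite hz /a exprVn real_normK ?num_real //.
  by field; rewrite z0 !gt_eqF.
clearbody t u c e a.
exists a, (t * a), (c * a), (u * a), (e * a); split.
  by split=> //; exact: mulr_gt0.
split.
- by rewrite !exprMn -hc; ring.
- by rewrite !exprMn -he; ring.
- by rewrite -hg; ring.
- by rewrite ler_pM2r.
Qed.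

Lemma triangles_balanced (k g a b c d e : rat) : k ^+ 2 < 1 -> 0 < g ->
  [/\ 0 < a, 0 < b, 0 < c, 0 < d & 0 < e] ->
  a ^+ 2 + b ^+ 2 - 2 * k * a * b = c ^+ 2 ->
  a ^+ 2 + d ^+ 2 + 2 * k * a * d = e ^+ 2 ->
  a * (b + d) = g ->
  exists a b c d e, [/\ 0 < a, 0 < b, 0 < c, 0 < d & 0 < e] /\
    [/\ a ^+ 2 + b ^+ 2 - 2 * k * a * b = c ^+ 2,
        a ^+ 2 + d ^+ 2 + 2 * k * a * d = e ^+ 2,
        a * (b + d) = g & b <= d].
Proof.
move=> k1 g0 pos hc he hg.
have [l [m [hlm lm]]] := cevian_pt_neq g0 (cevian_pt_of_triangles k1 pos hc he hg).
have [l' [m' [hlm' lk mk tu]]] := cevian_pt_near g0 hlm lm k1.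
exact: triangles_of_cevian_pt hlm' lk mk tu.
Qed.

(** * Passage between the triangles and the system *)

Lemma ltr_sqr_int (F : realDomainType) (r s : int) : `|s| < r ->
  s%:~R ^+ 2 < r%:~R ^+ 2 :> F.
Proof.
by rewrite -!rmorphXn /= ltr_int ltr_norml => /andP[]; nia.
Qed.

Lemma ltr_sqr_ratio (F : realFieldType) (r s : int) : `|s| < r ->
  (s%:~R / r%:~R) ^+ 2 < 1 :> F.
Proof.
move=> sr; have r0 : 0 < r by apply: le_lt_trans sr.
by rewrite expr_div_n ltr_pdivrMr ?exprn_gt0 ?ltr0z // mul1r ltr_sqr_int.
Qed.

Lemma system_solvable_in_Ntheta (r s : int) (n : nat) : `|s| < r ->
  system_solvable r s n -> in_Ntheta r s n.
Proof.
rewrite /in_Ntheta => sr [w [x [y [z]]]] /= [].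
have r0 : 0 < (r%:~R : rat) by rewrite ltr0z; apply: le_lt_trans sr.
have rs0 : 0 < (r%:~R : rat) ^+ 2 - s%:~R ^+ 2.
  by rewrite subr_gt0 ltr_sqr_int.
move: (r%:~R : rat) (s%:~R : rat) r0 rs0 => {sr}{}r {}s r0 rs0.
set N := 2 * n%:R - w => hy hz y0 w0 wn.
have N0 : 0 < N by rewrite /N; lra.
have x0 : x != 0.
  by apply: contraNneq y0 => x0; rewrite x0 !mul0r in hy; rewrite -sqrf_eq0 hy.
have z0 : z != 0.
  rewrite -sqrf_eq0 hz gt_eqF // ltr_wpDl ?sqr_ge0 //.
  by rewrite pmulr_rgt0 ?exprn_even_gt0 // pmulr_rgt0 ?exprn_gt0 //; lra.
(* The signs of [x], [y], [z] are free, so the sides are built from absolute values; the identities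
   to check involve these through squares. *)
have [X [X0 hX]] : exists X, 0 < X /\ X ^+ 2 = x ^+ 2.
  by exists `|x|; rewrite normr_gt0 real_normK ?num_real.
have [Y [Y0 hY]] : exists Y, 0 < Y /\ Y ^+ 2 = y ^+ 2.
  by exists `|y|; rewrite normr_gt0 real_normK ?num_real.
have [Z [Z0 hZ]] : exists Z, 0 < Z /\ Z ^+ 2 = z ^+ 2.
  by exists `|z|; rewrite normr_gt0 real_normK ?num_real.
have Yn0 : Y != 0 by rewrite gt_eqF.
have Xn0 : X != 0 by rewrite gt_eqF.
have rn0 : r != 0 by rewrite gt_eqF.
rewrite hy in hY; rewrite hz in hZ.
have hP : x * (x + (r + s) * w) * (x - (r - s) * w) != 0.
  by rewrite -hY expf_neq0.
have hd : 0 < x ^+ 2 + (r ^+ 2 - s ^+ 2) * w ^+ 2.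
  by rewrite ltr_wpDl ?sqr_ge0 // pmulr_rgt0 ?exprn_gt0.
exists (Y / (2 * X)), (r * w * X / Y), ((x ^+ 2 + (r ^+ 2 - s ^+ 2) * w ^+ 2) / (2 * Y)),
  (r * N * X / Y), (Z / (2 * Y)).
have pos1 : 0 < 2 * X by rewrite pmulr_rgt0.
have pos2 : 0 < 2 * Y by rewrite pmulr_rgt0.
split.
  by split; rewrite divr_gt0 // pmulr_lgt0 // mulr_gt0.
split; last split.
- have -> : (Y / (2 * X)) ^+ 2 + (r * w * X / Y) ^+ 2
      - 2 * s / r * (Y / (2 * X)) * (r * w * X / Y)
     = ((Y ^+ 2) ^+ 2 + 4 * r ^+ 2 * w ^+ 2 * (X ^+ 2) ^+ 2 - 4 * s * w * X ^+ 2 * Y ^+ 2)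
       / (4 * X ^+ 2 * Y ^+ 2).
    by field; rewrite Xn0 Yn0 rn0.
  rewrite expr_div_n [(2 * Y) ^+ 2]exprMn hX; move: (hP); rewrite hY => {}hP.
  rewrite !mulf_eq0 !negb_or in hP; case/andP: hP => /andP[h1 h2] h3.
  by field; rewrite h1 h2 h3.
- have -> : (Y / (2 * X)) ^+ 2 + (r * N * X / Y) ^+ 2
      + 2 * s / r * (Y / (2 * X)) * (r * N * X / Y)
     = ((Y ^+ 2) ^+ 2 + 4 * r ^+ 2 * N ^+ 2 * (X ^+ 2) ^+ 2 + 4 * s * N * X ^+ 2 * Y ^+ 2)
       / (4 * X ^+ 2 * Y ^+ 2).
    by field; rewrite Xn0 Yn0 rn0.
  rewrite expr_div_n [(2 * Y) ^+ 2]exprMn hX hZ; move: (hP); rewrite hY => {}hP.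
  rewrite !mulf_eq0 !negb_or in hP; case/andP: hP => /andP[h1 h2] h3.
  by clearbody N; field; rewrite h1 h2 h3.
by rewrite /N; field; rewrite Xn0 Yn0.
Qed.

Lemma balanced_system_solvable (r s : int) (n : nat) (a b c d e : rat) : `|s| < r ->
  [/\ 0 < a, 0 < b, 0 < c, 0 < d & 0 < e] ->
  a ^+ 2 + b ^+ 2 - 2 * (s%:~R / r%:~R) * a * b = c ^+ 2 ->
  a ^+ 2 + d ^+ 2 + 2 * (s%:~R / r%:~R) * a * d = e ^+ 2 ->
  a * (b + d) = r%:~R * n%:R -> b <= d ->
  system_solvable r s n.
Proof.
move=> sr [a0 b0 c0 d0 e0] hc he hn bd; rewrite /system_solvable /=.
have r0 : 0 < (r%:~R : rat) by rewrite ltr0z; apply: le_lt_trans sr.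
have k1 : ((s%:~R : rat) / r%:~R) ^+ 2 < 1.
  exact: ltr_sqr_ratio.
have rn0 : (r%:~R : rat) != 0 by rewrite gt_eqF.
have sE : (s%:~R : rat) = s%:~R / r%:~R * r%:~R by rewrite divfK.
rewrite sE; move: (s%:~R / r%:~R) k1 hc he => k k1 hc he.
move: (r%:~R : rat) r0 rn0 hn => R r0 rn0 hn {sE sr r s}.
have nE : n%:R = a * (b + d) / R by rewrite hn mulrC mulKf.
rewrite nE.
exists (2 * a * b / R), (2 * a * (a - k * b + c)), (4 * a ^+ 2 * (a - k * b + c)),
  (8 * a ^+ 2 * (a - k * b + c) * e).
have q0 : 0 < a - k * b + c.
  have h : (k * b - a) ^+ 2 < c ^+ 2.
    have : 0 < b ^+ 2 * (1 - k ^+ 2) by rewrite mulr_gt0 ?exprn_gt0 ?subr_gt0.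
    by rewrite -hc; lra.
  have [//|h'] := ltP 0 (a - k * b + c).
  have : c ^+ 2 <= (k * b - a) ^+ 2 by rewrite ler_pXn2r ?nnegrE //; lra.
  by rewrite leNgt h.
(* The quadratic equation of [a - k * b + c] given by the law of cosines; it reduces both equations
   of the system. *)
have key : (a - k * b + c) ^+ 2 + 2 * k * b * (a - k * b + c) - (1 - k ^+ 2) * b ^+ 2
           = 2 * a * (a - k * b + c).
  by rewrite sqrrD -hc; ring.
split.
- have -> : 2 * a * (a - k * b + c)
     * (2 * a * (a - k * b + c) + (R + k * R) * (2 * a * b / R)) *
     (2 * a * (a - k * b + c) - (R - k * R) * (2 * a * b / R)) =
     8 * a ^+ 3 * (a - k * b + c) * ((a - k * b + c) ^+ 2 + 2 * k * b * (a - k * b + c)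
       - (1 - k ^+ 2) * b ^+ 2) by field.
  by rewrite key; ring.
- have -> : (2 * a * (a - k * b + c)) ^+ 2
       + 2 * (k * R) * (2 * (a * (b + d) / R) - 2 * a * b / R + 2 * a * b / R)
         * (2 * a * (a - k * b + c))
       - (R ^+ 2 - (k * R) ^+ 2) * (2 * a * b / R) ^+ 2 =
     4 * a ^+ 2 * (((a - k * b + c) ^+ 2 + 2 * k * b * (a - k * b + c)
       - (1 - k ^+ 2) * b ^+ 2) + 2 * k * d * (a - k * b + c)) by field.
  by rewrite key exprMn -he; field.
- by rewrite gt_eqF // !pmulr_rgt0 ?exprn_gt0.
- by rewrite divr_gt0 // !pmulr_rgt0.
rewrite ler_pM2r ?invr_gt0 // -mulrA mulrCA ler_pM2l //; lra.
Qed.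

Theorem theorem3p2 (r s : int) (n : nat) :
  0 <= `|s| -> `|s| < r -> gcdz r s = 1%N ->
  (in_Ntheta r s n <-> system_solvable r s n).
Proof.
move=> _ sr _; split; last exact: system_solvable_in_Ntheta.
move=> [a [b [c [d [e [pos [hc [he hn]]]]]]]].
have r0 : 0 < (r%:~R : rat) by rewrite ltr0z; apply: le_lt_trans sr.
have k1 : ((s%:~R : rat) / r%:~R) ^+ 2 < 1.
  exact: ltr_sqr_ratio.
have g0 : 0 < (r%:~R : rat) * n%:R.
  by rewrite -hn; case: pos => a0 b0 _ d0 _; rewrite mulr_gt0 ?addr_gt0.
rewrite -[2 * _ / _]mulrA in hc he.
have [a' [b' [c' [d' [e' [pos' [hc' he' hn' bd]]]]]]] :=
  triangles_balanced k1 g0 pos hc he hn.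
exact: balanced_system_solvable sr pos' hc' he' hn' bd.
Qed.
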